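(* Let $T$ be the measure-preserving transformation associated with a sequence of functions $(\psi_n)_{n\ge0}$. Then $T$ is ergodic if and only if 1. $\psi_0=-1$ and, for all $n\ge1$, $\displaystyle\prod_{(u_1,\ldots,u_n)\in\{-1,+1\}^n}\psi_n(u_1,\ldots,u_n)=-1$; or equivalently, if and only if 2. $\psi_0=-1$ and, for all $n\ge1$, $\max(u_1,\ldots,u_n)$ appears in the representation $\psi_n(u_1,\ldots,u_n)=\prod_{K\in\mathbb{K}(n)}u_{[K]}^{\beta_{n+1,K}}$; that is, $\beta_{n+1,\{1,\ldots,n\}}=1$.
   Context: Let $\Omega$ be the space of integer-valued sequences $x=(x_n)_{n\ge0}$ with $x_0=0$ and $x_n-x_{n-1}\in\{-1,+1\}$ for all $n\ge1$, endowed with the product sigma-field and the probability measure under which the coordinate process is a simple symmetric random walk started at $0$. Given a constant $\psi_0\in\{-1,+1\}$ and functions $\psi_n:\{-1,+1\}^n\to\{-1,+1\}$, $n\ge1$, the associated transformation $T:\Omega\to\Omega$ is $T(x)=y$ with $y_0=0$ and $y_n=\sum_{k=1}^nv_k$, where $u_k=x_k-x_{k-1}$ and $v_k=\psi_{k-1}(u_1,\ldots,u_{k-1})u_k$ ($v_1=\psi_0u_1$); $T$ is measure-preserving. $T$ is ergodic if every measurable set $A$ with $T^{-1}(A)=A$ has probability $0$ or $1$. Notation: $\mathbb{K}(n)$ is the power set of $\{1,\ldots,n\}$; for $(u_1,\ldots,u_n)\in\{-1,+1\}^n$, $u_{[\emptyset]}=-1$ and $u_{[K]}=\max_{k\in K}u_k$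 for nonempty $K\in\mathbb{K}(n)$. Every function $\psi_n:\{-1,+1\}^n\to\{-1,+1\}$ has a unique representation $\psi_n(u_1,\ldots,u_n)=\prod_{K\in\mathbb{K}(n)}u_{[K]}^{\beta_{n+1,K}}$ with coefficients $\beta_{n+1,K}\in\{0,1\}$. *)

(* Defs.v *)
From HB Require Import structures.
From mathcomp Require Import all_boot all_order all_algebra.
From mathcomp Require Import finmap.
From mathcomp Require Import boolp classical_sets functions cardinality.
From mathcomp Require Import reals ereal measure.
Set Implicit Arguments.
Unset Strict Implicit.
Unset Printing Implicit Defensive.
Import Order.TTheory GRing.Theory Num.Theory.
Local Open Scope classical_set_scope.
Local Open Scope ring_scope.

(* The two-element set {-1, +1}, as a finite subtype of int. *)
Notation pm1 := (seq_sub [:: (-1)%R : int; 1%R : int]).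

Definition minus_one : pm1 := SeqSub (mem_head (-1) [:: 1]).
Definition plus_one : pm1 := SeqSub (mem_last (-1) [:: 1]).

Record Omega := MkOmega {
  position :> nat -> int;
  position0 : position 0%N = 0;
  position_step : forall n, position n.+1 - position n \in [:: -1; 1]
}.

HB.instance Definition _ := gen_eqMixin Omega.
HB.instance Definition _ := gen_choiceMixin Omega.

Definition walk_fun (v : nat -> pm1) (n : nat) : int := \sum_(k < n) val (v k).

Lemma walk_fun0 v : walk_fun v 0 = 0.
Proof. exact: big_ord0. Qed.

Lemma walk_fun_step v n : walk_fun v n.+1 - walk_fun v n \in [:: -1; 1].
Proof. by rewrite /walk_fun big_ord_recr/= addrC addrK; exact: ssvalP. Qed.

(* The steps are indexed from 0: v k is the step from time k to time k + 1. *)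
Definition walk (v : nat -> pm1) : Omega :=
  MkOmega (walk_fun0 v) (walk_fun_step v).

HB.instance Definition _ :=
  isPointed.Build Omega (walk (fun=> plus_one)).

(* Trace on Omega of the product sigma-field of the discrete sigma-fields. *)
Definition coordinate_sets : set (set Omega) :=
  [set A | exists n (B : set int), A = (fun x : Omega => x n) @^-1` B].

HB.instance Definition _ :=
  Measurable.copy Omega (g_sigma_algebraType coordinate_sets).

(* incr k x is u_(k+1) = x_(k+1) - x_k. *)
Definition incr (k : nat) (x : Omega) : int := x k.+1 - x k.

Definition step (x : Omega) (k : nat) : pm1 := SeqSub (position_step x k).

(* int is discrete: every set of values is measurable. *)
Definition mutually_independent d (S : measurableType d) (R : realType)
    (P : probability S R) (X : nat -> S -> int) : Prop :=
  forall (J : {fset nat}) (B : nat -> set int),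
    P (\bigcap_(j in [set` J]) (X j @^-1` B j)) =
    (\prod_(j <- J) P (X j @^-1` B j))%E.

Definition simple_symmetric_random_walk (R : realType)
    (P : probability Omega R) : Prop :=
  [/\ forall k, P (incr k @^-1` [set 1]) = (2^-1)%:E,
      forall k, P (incr k @^-1` [set -1]) = (2^-1)%:E
    & mutually_independent P incr].

Definition ergodic d (S : measurableType d) (R : realType)
    (P : probability S R) (f : S -> S) : Prop :=
  forall A : set S, measurable A -> f @^-1` A = A ->
    P A = 0%E \/ P A = 1%E.

Lemma mul_pm1 (a b : pm1) : val a * val b \in [:: -1; 1].
Proof.
by case: a b => a /= /[!inE] /orP[] /eqP-> [b /= /[!inE] /orP[] /eqP->].
Qed.

(* new_step psi x k is v_(k+1) = psi_k(u_1, ..., u_k) u_(k+1). *)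
Definition new_step (psi : forall n, n.-tuple pm1 -> pm1) (x : Omega)
    (k : nat) : pm1 :=
  SeqSub (mul_pm1 (psi k [tuple step x i | i < k]) (step x k)).

Definition transformation (psi : forall n, n.-tuple pm1 -> pm1) (x : Omega) :
  Omega := walk (new_step psi x).

(* u_[K]: starting the maximum at -1 gives -1 for the empty set and does not
   affect the other maxima, all entries being at least -1. *)
Definition max_on n (u : n.-tuple pm1) (K : {set 'I_n}) : int :=
  \big[Num.max/-1]_(k in K) val (tnth u k).

Definition represents n (f : n.-tuple pm1 -> pm1)
    (beta : {ffun {set 'I_n} -> bool}) : Prop :=
  forall u, val (f u) = \prod_(K : {set 'I_n}) max_on u K ^+ beta K.

Section representation.
Variable n : nat.
Implicit Types (b : {ffun {set 'I_n} -> bool}) (u : n.-tuple pm1).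

Let neg u : {set 'I_n} := [set k | val (tnth u k) == -1].

Let of_neg (S : {set 'I_n}) : n.-tuple pm1 :=
  [tuple if k \in S then minus_one else plus_one | k < n].

Let of_negK : cancel of_neg neg.
Proof. by move=> S; apply/setP => k; rewrite inE tnth_mktuple; case: ifP. Qed.

Let max_onE u K : max_on u K = (-1) ^+ (K \subset neg u).
Proof.
have [KN|/fintype.subsetPn[k kK kN]] := boolP (K \subset neg u); rewrite /max_on.
  rewrite (eq_bigr (fun=> -1)); first by elim/big_ind: _ => [|x y -> ->|].
  by move=> k /(fintype.subsetP KN); rewrite inE => /eqP.
have val1 j : val (tnth u j) <= 1.
  by case: (tnth u j) => v /= /[!inE] /orP[] /eqP->.
apply/eqP; rewrite eq_le; apply/andP; split.
  by elim/big_ind: _ => // x y x1 y1; rewrite ge_max x1.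
rewrite (bigD1 k)//= le_max; apply/orP; left.
by move: kN; rewrite inE; case: (tnth u k) => v /= /[!inE] /orP[] /eqP->.
Qed.

Let zeta b : {ffun {set 'I_n} -> bool} :=
  [ffun S : {set 'I_n} => \big[addb/false]_(K : {set 'I_n} | K \subset S) b K].

Let zeta_inj : injective zeta.
Proof.
move=> b b' /ffunP E; apply/ffunP => S.
have [m] := ubnP #|S|; elim: m S => // m IH S; rewrite ltnS => Sm.
have := E S; rewrite !ffunE (bigD1 S)//= [RHS](bigD1 S)//=.
rewrite (eq_bigr b'); first exact: addIb.
move=> K /andP[KS KnS]; apply: IH; apply: leq_trans Sm; apply: proper_card.
by rewrite finset.properEneq KnS.
Qed.

Let representsE u b :
  \prod_(K : {set 'I_n}) max_on u K ^+ b K = (-1) ^+ zeta b (neg u).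
Proof.
rewrite ffunE (big_morph (fun c : bool => (-1) ^+ c : int) (id1 := 1)
  (op1 := *%R) (@signr_addb _))// [RHS]big_mkcond/=.
apply: eq_bigr => K _; rewrite max_onE; case: ifP => _.
  by rewrite expr1.
by rewrite expr1n.
Qed.

Lemma representation (f : n.-tuple pm1 -> pm1) : exists! b, represents f b.
Proof.
have [zinv zK zinvK] := injF_bij zeta_inj.
have negK : cancel neg of_neg.
  move=> u; apply: eq_from_tnth => k; rewrite tnth_mktuple inE.
  by apply: val_inj; case: (tnth u k) => v /= /[!inE] /orP[] /eqP->.
exists (zinv [ffun S : {set 'I_n} => val (f (of_neg S)) == -1]); split.
  move=> u; rewrite representsE zinvK ffunE negK.
  by case: (f u) => v /= /[!inE] /orP[] /eqP->.
move=> b bP; apply: zeta_inj; rewrite zinvK; apply/ffunP => S.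
by rewrite ffunE bP representsE of_negK; case: (zeta b S).
Qed.

End representation.

(* coef (psi n) K is beta_(n+1,K), with {0,1} encoded as bool. *)
Definition coef n (f : n.-tuple pm1 -> pm1) : {ffun {set 'I_n} -> bool} :=
  sval (cid (representation f)).

(* Main.v *)
Require Import Defs.
From mathcomp Require Import all_boot all_order all_algebra.
From mathcomp Require Import finmap.
From mathcomp Require Import boolp classical_sets cardinality fsbigop.
From mathcomp Require Import reals ereal measure.
Set Implicit Arguments.
Unset Strict Implicit.
Unset Printing Implicit Defensive.
Import Order.TTheory GRing.Theory Num.Theory.
Local Open Scope ring_scope.

(** The first n increments of T x depend only on the first n increments of x,
and determine them. So T induces, for each n, a permutation [past_map psi n] of
the 2^n sign vectors of length n, and the whole question reduces to these finite
permutations: T is ergodic if and only if each of them has a single orbit.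

If some [past_map psi n] has two orbits, the set of paths whose past of length n
lies in one of them is invariant and has probability strictly between 0 and 1
([ergodic_single_orbit]). Conversely, T preserves P and pulls the cylinder over
the image of s back to the cylinder over s; hence, for an invariant set A,
P (A `&` cylinder s) is constant along the orbit of s. If there is one orbit
only, P (A `&` cylinder s) = P A * P (cylinder s) for every cylinder. Cylinders
form a pi-system that generates the sigma-field, so A is independent of every
measurable set, in particular of itself, and P A is 0 or 1
([single_orbit_ergodic]).

The single orbit condition is decided one level at a time. Forgetting the last
sign makes level n + 1 a two-sheeted cover of level n, on which the dynamics
multiplies the last sign by psi_n of the past. Going once around a single orbit
of level n multiplies the last sign by the product of all the values of psi_n:
the cover is connected if that product is -1 and splits in two if it is 1
([double_cover_single_orbit]). At level 0 there is one point, whence the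
condition that all these products be -1, the case n = 0 being psi_0 = -1.

Finally, the product of max_on u K over all u is (-1) to the number of vectors u
equal to -1 on K, that is to the power 2^(n - #|K|), which is odd only when K is
the full set. So the product of all values of psi_n is (-1)^(beta_(n+1, full))
([prod_coef]). *)

(** * Transitive maps on finite sets and their double covers *)

Definition single_orbit (X : finType) (f : X -> X) : Prop :=
  forall x y : X, fconnect f x y.

Lemma single_orbit_order (X : finType) (f : X -> X) (x : X) :
  single_orbit f -> order f x = #|X|.
Proof. by move=> fX; apply: eq_card => y; rewrite inE fX. Qed.

Lemma single_orbit_prod (X : finType) (f : X -> X) (c : X -> int) (x : X) :
  single_orbit f -> \prod_(j < #|X|) c (iter j f x) = \prod_y c y.
Proof.
move=> fX.
have <- : \prod_(y <- orbit f x) c y = \prod_y c y.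
  apply: perm_big; apply: uniq_perm (orbit_uniq f x) (index_enum_uniq _) _.
  by move=> y; rewrite mem_index_enum -fconnect_orbit fX.
by rewrite (big_nth x) big_mkord /orbit size_traject single_orbit_order//;
  apply: eq_bigr => j _; rewrite nth_traject// single_orbit_order.
Qed.

Definition is_sign (a : int) : bool := a \in [:: -1; 1].

Lemma sign_cases a : is_sign a -> a = -1 \/ a = 1.
Proof. by rewrite /is_sign !inE => /orP[] /eqP ->; [left|right]. Qed.

Lemma sign_pm1 (a : pm1) : is_sign (val a).
Proof. exact: ssvalP. Qed.

Lemma pm1_cases (a : pm1) : a = minus_one \/ a = plus_one.
Proof.
by have /sign_cases[] := sign_pm1 a => aE; [left|right]; apply: val_inj.
Qed.

Lemma signM a b : is_sign a -> is_sign b -> is_sign (a * b).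
Proof. by move=> /sign_cases[] -> /sign_cases[] ->. Qed.

Lemma sign_prod (I : finType) (A : pred I) (F : I -> int) :
  (forall i, is_sign (F i)) -> is_sign (\prod_(i | A i) F i).
Proof. by move=> FS; elim/big_ind: _ => // x y; apply: signM. Qed.

(** A map F over f on a set Y of pairs (x, +1) and (x, -1), for x in X, that
multiplies the sign by c x. The pairs are given through the projection p and the
sign sg rather than as a product type, so that tuples of length n + 1 can be
used directly as a cover of tuples of length n. *)
Section double_cover.
Variables (X Y : finType) (f : X -> X) (F : Y -> Y).
Variables (p : Y -> X) (sg : Y -> int) (c : X -> int).
Hypothesis pF : forall y, p (F y) = f (p y).
Hypothesis sgF : forall y, sg (F y) = c (p y) * sg y.
Hypothesis p_sg_inj : forall y z, p y = p z -> sg y = sg z -> y = z.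
Hypothesis sg_sign : forall y, is_sign (sg y).
Hypothesis c_sign : forall x, is_sign (c x).
Hypothesis cardY : #|Y| = (2 * #|X|)%N.

Lemma iter_cover i y : p (iter i F y) = iter i f (p y).
Proof. by elim: i => //= i IH; rewrite pF IH. Qed.

Lemma iter_cover_sign i y :
  sg (iter i F y) = (\prod_(j < i) c (iter j f (p y))) * sg y.
Proof.
elim: i => [|i IH] /=; first by rewrite big_ord0 mul1r.
by rewrite sgF IH iter_cover big_ord_recr /= mulrA (mulrC (c _)).
Qed.

(** Follow a point y of the cover around the single orbit of the base: it comes
back over its starting point with its sign multiplied by the product of c. If
this is 1 the orbit closes up after #|X| < #|Y| steps; if it is -1, one more
turn reaches the other point of the same fibre. *)
Lemma double_cover_single_orbit :
  injective f -> single_orbit f -> (0 < #|X|)%N ->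
  (single_orbit F <-> \prod_x c x = -1).
Proof.
move=> finj fX X0.
have period y : p (iter #|X| F y) = p y.
  by rewrite iter_cover -(single_orbit_order (p y) fX) iter_order.
have monodromy y : sg (iter #|X| F y) = (\prod_x c x) * sg y.
  by rewrite iter_cover_sign single_orbit_prod.
split=> [FY|prodc y z].
- case: (sign_cases (sign_prod predT c_sign)) => // prodc.
  have /card_gt0P[y _] : (0 < #|Y|)%N by rewrite cardY muln_gt0.
  have Fy : iter #|X| F y = y.
    by apply: p_sg_inj; rewrite ?period// monodromy prodc mul1r.
  have : findex F y (iter #|X| F y) = #|X|.
    rewrite findex_iter// single_orbit_order// cardY mul2n -addnn.
    by rewrite -ltn_subLR// subnn.
  by rewrite Fy findex0 => X0'; rewrite -X0' in X0.
- have /iter_findex := fX (p y) (p z); set i := findex _ _ _ => fi.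
  have [sgi|] := eqVneq (sg (iter i F y)) (sg z).
    rewrite -(_ : iter i F y = z) ?fconnect_iter//.
    by apply: p_sg_inj; rewrite ?iter_cover.
  move=> sgi; rewrite -(_ : iter (i + #|X|) F y = z) ?fconnect_iter//.
  rewrite iterD; apply: p_sg_inj; first by rewrite iter_cover period.
  rewrite iter_cover_sign period monodromy prodc mulN1r mulrN -iter_cover_sign.
  have := sg_sign z; have := sg_sign (iter i F y).
  by move: sgi => /[swap] /sign_cases[] -> /[swap] /sign_cases[] ->.
Qed.

End double_cover.

(** * The action on finite pasts *)

Section pasts.
Implicit Types (x y : Omega) (n k : nat).

Lemma step_walk v k : step (walk v) k = v k.
Proof.
by apply: val_inj; rewrite /= /walk_fun big_ord_recr/= addrC addrK.
Qed.

Definition past n x : n.-tuple pm1 := [tuple step x k | k < n].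

Lemma past_eqP n x y :
  past n x = past n y <-> forall k, (k < n)%N -> step x k = step y k.
Proof.
split=> [xy k kn|xy]; last by apply: eq_mktuple => k; apply: xy.
by have := congr1 (fun s => tnth s (Ordinal kn)) xy; rewrite /= !tnth_mktuple.
Qed.

Lemma pastS_eqP n x y :
  past n.+1 x = past n.+1 y <->
  past n x = past n y /\ step x n = step y n.
Proof.
rewrite !past_eqP; split=> [xy|[xy xyn] k].
  by split=> [k kn|]; apply: xy; rewrite // ltnS ltnW.
by rewrite ltnS leq_eqVlt => /predU1P[->//|]; apply: xy.
Qed.

Definition extend n (s : n.-tuple pm1) : Omega := walk (nth plus_one s).

Lemma past_extend n (s : n.-tuple pm1) : past n (extend s) = s.
Proof.
by apply: eq_from_tnth => k; rewrite tnth_mktuple step_walk -tnth_nth.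
Qed.

End pasts.

Section dynamics.
Variable psi : forall n, n.-tuple pm1 -> pm1.
Local Notation T := (transformation psi).
Implicit Types (x y : Omega) (n k : nat).

Lemma step_transformation x k :
  val (step (T x) k) = val (psi (past k x)) * val (step x k).
Proof. by rewrite step_walk. Qed.

(** For equal pasts of x and y, the next increments of T x and T y are those of x
and y times the same sign, which cancels. The equivalence gives at once that T
acts on pasts and that this action is injective. *)
Lemma past_transformation n x y :
  past n x = past n y <-> past n (T x) = past n (T y).
Proof.
elim: n => [|n IH]; first by rewrite !past_eqP.
rewrite !pastS_eqP; split=> -[xy xyn].
  split; first exact/IH.
  by apply: val_inj; rewrite !step_transformation xy xyn.
have {}xy := (IH.2 xy); split=> //; apply: val_inj.
move: xyn => /(congr1 val); rewrite !step_transformation xy.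
apply: mulfI; have := sign_pm1 (psi (past n y)).
by move=> /sign_cases[] ->.
Qed.

Definition past_map n (s : n.-tuple pm1) : n.-tuple pm1 :=
  past n (T (extend s)).

Lemma past_mapE n x : past_map (past n x) = past n (T x).
Proof. by apply: (past_transformation _ _ _).1; rewrite past_extend. Qed.

Lemma past_map_inj n : injective (@past_map n).
Proof. by move=> s t /(past_transformation _ _ _).2; rewrite !past_extend. Qed.

Lemma card_pm1_tuple n : #|{: n.-tuple pm1}| = (2 ^ n)%N.
Proof. by rewrite card_tuple card_seq_sub. Qed.

Lemma single_orbit_pastS n : single_orbit (@past_map n) ->
  (single_orbit (@past_map n.+1) <-> \prod_(u : n.-tuple pm1) val (psi u) = -1).
Proof.
move=> Tn; apply: (@double_cover_single_orbit _ _ (@past_map n) (@past_map n.+1)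
  (fun s : n.+1.-tuple pm1 => past n (extend s))
  (fun s => val (step (extend s) n)) (fun u => val (psi u))).
- move=> s; rewrite past_mapE.
  have : past n.+1 (extend (past_map s)) = past n.+1 (T (extend s)).
    by rewrite past_extend.
  by case/pastS_eqP.
- move=> s; rewrite -step_transformation; congr val.
  have : past n.+1 (extend (past_map s)) = past n.+1 (T (extend s)).
    by rewrite past_extend.
  by case/pastS_eqP.
- move=> s t st /val_inj stn; rewrite -(past_extend s) -(past_extend t).
  exact/pastS_eqP.
- by move=> s; apply: sign_pm1.
- by move=> u; apply: sign_pm1.
- by rewrite !card_pm1_tuple expnS.
- exact: past_map_inj.
- exact: Tn.
- by rewrite card_pm1_tuple expn_gt0.
Qed.

Lemma single_orbit_pastP :
  (forall n, single_orbit (@past_map n)) <->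
  forall n, \prod_(u : n.-tuple pm1) val (psi u) = -1.
Proof.
split=> [Tn n|prod_psi]; first exact/single_orbit_pastS.
elim=> [s t|n IH]; last exact/single_orbit_pastS.
by rewrite (tuple0 s) (tuple0 t) connect0.
Qed.

End dynamics.

(** * The product of the values of a sign function *)

Section representation_sign.
Variable n : nat.
Implicit Types (u : n.-tuple pm1) (K : {set 'I_n}).

Definition flip (k : 'I_n) u : n.-tuple pm1 :=
  [tuple if i == k then (if tnth u i == plus_one then minus_one else plus_one)
         else tnth u i | i < n].

Lemma flipK k : involutive (flip k).
Proof.
move=> u; apply: eq_from_tnth => i; rewrite !tnth_mktuple.
by case: (i == k) => //; have [->|->] := pm1_cases (tnth u i).
Qed.

(** Flipping coordinate k pairs off the sign vectors, and the two members of a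
pair contribute a square. *)
Lemma prod_flip (k : 'I_n) (g : n.-tuple pm1 -> int) :
  (forall u, is_sign (g u)) -> (forall u, g (flip k u) = g u) -> \prod_u g u = 1.
Proof.
move=> gS gk; rewrite (bigID (fun u => tnth u k == plus_one))/=.
rewrite (reindex_inj (inv_inj (flipK k)))/=.
have flipk u : (tnth (flip k u) k == plus_one) = (tnth u k != plus_one).
  by rewrite tnth_mktuple eqxx; have [->|->] := pm1_cases (tnth u k).
under eq_bigl do rewrite flipk.
under eq_bigr do rewrite gk.
by have /sign_cases[] := sign_prod (fun u => tnth u k != plus_one) gS => ->.
Qed.

Lemma sign_max_on u K : is_sign (max_on u K).
Proof.
rewrite /max_on; elim/big_ind: _ => //; last by move=> k _; apply: sign_pm1.
by move=> a b /sign_cases[] -> /sign_cases[] ->.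
Qed.

(** For K proper, the maximum ignores some coordinate, so its values cancel in
pairs; for K full, only the vector with all entries -1 contributes a factor
-1. *)
Lemma prod_max_on K : \prod_u max_on u K = (-1) ^+ (K == [set: 'I_n]%SET).
Proof.
have [->|KT] := eqVneq K [set: 'I_n]%SET; last first.
  have /fintype.subsetPn[k _ kK] : ~~ ([set: 'I_n]%SET \subset K).
    by rewrite finset.subTset.
  apply: (@prod_flip k) => u; first exact: sign_max_on.
  rewrite /max_on; apply: eq_bigr => i iK; rewrite tnth_mktuple.
  by case: eqP => // ik; rewrite -ik iK in kK.
rewrite (bigD1 [tuple of nseq n minus_one])//= expr1 big1 ?mulr1.
  rewrite /max_on; elim/big_ind: _ => // [a b -> ->//|k _].
  by rewrite tnth_nseq.
move=> u uN; have [max1|//] := sign_cases (sign_max_on u [set: 'I_n]%SET).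
case/eqP: uN; apply: eq_from_tnth => k; rewrite tnth_nseq.
have [//|uk] := pm1_cases (tnth u k).
have : val (tnth u k) <= max_on u [set: 'I_n]%SET.
  by rewrite /max_on (bigD1 k) ?inE//= le_max lexx.
by rewrite max1 uk.
Qed.

Lemma prod_coef (f : n.-tuple pm1 -> pm1) :
  \prod_u val (f u) = (-1) ^+ coef f [set: 'I_n]%SET.
Proof.
rewrite /coef; case: cid => b [/= fb _].
under eq_bigr do rewrite fb.
rewrite exchange_big/=.
under eq_bigr do rewrite prodrXl prod_max_on.
rewrite (bigD1 [set: 'I_n]%SET)//= eqxx expr1 big1 ?mulr1// => K KT.
by rewrite (negbTE KT) expr1n.
Qed.

End representation_sign.

(** * Cylinders generate the sigma-field *)

Section measurability.
Local Open Scope classical_set_scope.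

Definition cylinder n (s : n.-tuple pm1) : set Omega := past n @^-1` [set s].

Lemma cylinderP n (s : n.-tuple pm1) x :
  cylinder s x <-> forall k, (k < n)%N -> step x k = nth plus_one s k.
Proof.
rewrite /cylinder /= -[X in _ = X]past_extend past_eqP.
by split=> xs k kn; rewrite xs// step_walk.
Qed.

Definition cylinders : set (set Omega) :=
  [set A | A = set0 \/ exists n (s : n.-tuple pm1), A = cylinder s].

(** Two cylinders are nested or disjoint; the empty set is among [cylinders] to
account for the latter case. *)
Lemma cylinders_setI : setI_closed cylinders.
Proof.
suff nested m n (s : m.-tuple pm1) (t : n.-tuple pm1) : (m <= n)%N ->
    cylinders (cylinder s `&` cylinder t).
  move=> _ _ [->|[m [s ->]]] [->|[n [t ->]]]; rewrite ?set0I ?setI0; try by left.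
  by have /orP[|nm] := leq_total m n; [exact: nested|rewrite setIC; exact: nested].
move=> mn; have [st|st] := eqVneq (past m (extend t)) s.
  right; exists n, t; apply/setIidPr => x /= xt; rewrite -st.
  rewrite -(past_extend t) in xt.
  by apply/past_eqP => k km; apply: (past_eqP _ _ _).1 xt _ (leq_trans km mn).
left; apply/seteqP; split=> // x [/= xs xt]; case/eqP: st; rewrite -xs.
rewrite -(past_extend t) in xt.
by apply/past_eqP => k km; apply/esym/((past_eqP _ _ _).1 xt)/(leq_trans km mn).
Qed.

Lemma position_walk (x : Omega) n : x n = \sum_(k < n) val (step x k).
Proof.
elim: n => [|n IH]; first by rewrite big_ord0 position0.
by rewrite big_ord_recr /= -IH addrC subrK.
Qed.

Lemma measurable_cylinder n (s : n.-tuple pm1) : measurable (cylinder s).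
Proof.
have m_position k (i : int) : measurable [set x : Omega | x k = i].
  by apply: sub_sigma_algebra; exists k, [set i].
have m_step k a : measurable [set x : Omega | step x k = a].
  rewrite (_ : [set _ | _] = \bigcup_(i : int)
    ([set x : Omega | x k.+1 = val a + i] `&` [set x : Omega | x k = i])).
    by apply: countable_bigcupT_measurable => // i; apply: measurableI.
  apply/seteqP; split=> x /=.
    by move=> <-; exists (x k) => //; split => //=; rewrite subrK.
  by move=> [i _ [/= xk1 xk]]; apply: val_inj; rewrite /= xk1 xk addrK.
rewrite (_ : cylinder s = \bigcap_(k < n) [set x | step x k = nth plus_one s k]).
  by apply: bigcap_measurableType.
apply/seteqP; split=> x /=.
  by move=> /cylinderP xs k /= kn; apply: xs.
by move=> xs; apply/cylinderP.
Qed.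

(** The position at time n is a function of the past of length n, so an event on
it is a finite union of cylinders; conversely, a cylinder is a finite
intersection of events on increments, each a countable union of events on two
successive positions. *)
Lemma measurable_cylinders : measurable = <<s cylinders >> :> set (set Omega).
Proof.
apply/seteqP; split; last first.
  apply: smallest_sub; first exact: sigma_algebra_measurable.
  by move=> _ [->|[n [s ->]]]; [exact: measurable0|exact: measurable_cylinder].
apply: smallest_sub; first exact: smallest_sigma_algebra.
move=> _ [n [B ->]].
rewrite (_ : _ @^-1` B = \bigcup_(s in [set s : n.-tuple pm1 | B (extend s n)])
  cylinder s).
  apply: (@fin_bigcup_measurable _ (g_sigma_algebraType cylinders)).
    exact: finite_finset.
  by move=> s _; apply: sub_sigma_algebra; right; exists n, s.
have posE (x : Omega) : extend (past n x) n = x n.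
  rewrite !position_walk; apply: eq_bigr => k _; congr val.
  have := past_extend (past n x) => /past_eqP; exact.
apply/seteqP; split=> x /=.
  by move=> Bx; exists (past n x) => //; move: Bx; rewrite -posE.
by move=> [s Bs xs]; rewrite -posE xs.
Qed.

Lemma eq_measure_cylinders (R : realType) (m1 m2 : {measure set Omega -> \bar R}) :
  (m1 setT < +oo)%E ->
  (forall n (s : n.-tuple pm1), m1 (cylinder s) = m2 (cylinder s)) ->
  forall A, measurable A -> m1 A = m2 A.
Proof.
move=> m1T m12.
have cyl0 : cylinder [tuple] = setT :> set Omega.
  by apply/seteqP; split => // x _; rewrite /cylinder/= [LHS]tuple0.
apply: (measure_unique cylinders (fun=> setT)).
- exact: measurable_cylinders.
- exact: cylinders_setI.
- by move=> _; right; exists 0%N, [tuple].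
- by rewrite bigcup_const.
- by move=> _ [->|[n [s ->]]]; rewrite ?measure0.
- by [].
Qed.

End measurability.

(** * Ergodicity and transitivity on pasts *)

Section ergodicity.
Local Open Scope classical_set_scope.
Variables (R : realType) (P : probability Omega R).
Hypothesis hP : simple_symmetric_random_walk P.

Lemma probability_cylinder n (s : n.-tuple pm1) :
  P (cylinder s) = ((2 ^- n)%R)%:E.
Proof.
have [J memJ sizeJ] : exists2 J : {fset nat}, (forall k, (k \in J) = (k < n)%N)
    & size J = n.
  exists (seq_fset tt (iota 0 n)) => [k|]; first by rewrite seq_fsetE mem_iota.
  by rewrite size_seq_fset undup_id ?iota_uniq// size_iota.
have [P1 PN1 /(_ J (fun k => [set val (nth plus_one s k)])) indep] := hP.
rewrite (_ : cylinder s =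
    \bigcap_(k in [set` J]) (incr k @^-1` [set val (nth plus_one s k)])).
  rewrite indep (eq_bigr (fun=> (2^-1)%:E)); last first.
    by move=> k _; have [->|->] := pm1_cases (nth plus_one s k).
  rewrite big_const_seq count_predT sizeJ.
  elim: n {s J memJ sizeJ indep} => [|n IH]; first by rewrite /= expr0 invr1.
  by rewrite /= IH -EFinM exprS invfM.
apply/seteqP; split=> x.
  move=> /cylinderP xs k /=; rewrite memJ => kn.
  by rewrite -[LHS]/(val (step x k)) xs.
move=> xs; apply/cylinderP => k kn; apply: val_inj.
by apply: xs; rewrite /= memJ.
Qed.

Variable psi : forall n, n.-tuple pm1 -> pm1.
Local Notation T := (transformation psi).

Lemma preimage_cylinder n (s : n.-tuple pm1) :
  T @^-1` cylinder (past_map psi s) = cylinder s.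
Proof.
apply/seteqP; split=> x; rewrite /cylinder /= -past_mapE.
  exact: past_map_inj.
by move=> ->.
Qed.

Lemma past_map_surj n (s : n.-tuple pm1) : exists t, past_map psi t = s.
Proof.
have [g _ gK] := injF_bij (@past_map_inj psi n).
by exists (g s); rewrite gK.
Qed.

Lemma measurable_transformation : measurable_fun setT T.
Proof.
apply: (@measurability _ _ Omega Omega setT T cylinders measurable_cylinders).
move=> _ [A cA <-]; rewrite setTI.
case: cA => [->|[n [s ->]]]; first by rewrite preimage_set0.
have [t <-] := past_map_surj s.
by rewrite preimage_cylinder; exact: measurable_cylinder.
Qed.

(** By injectivity of the action on pasts the preimage of a cylinder is a single
cylinder of the same length, hence of the same probability. *)
Lemma measure_preserving A : measurable A -> P (T @^-1` A) = P A.
Proof.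
apply: (@eq_measure_cylinders R (pushforward P T) P) => [|mT|mT n s].
- exact: measurable_transformation.
- by rewrite /= /pushforward preimage_setT probability_setT ltry.
- rewrite /= /pushforward; have [t <-] := past_map_surj s.
  by rewrite preimage_cylinder !probability_cylinder.
Qed.

(** The paths whose past lies in the orbit of s form an invariant event; it has
positive probability as it contains the cylinder over s, and its complement
contains the cylinder over any t outside the orbit. *)
Lemma ergodic_single_orbit n : ergodic P T -> single_orbit (@past_map psi n).
Proof.
move=> erg s t; apply: contrapT => st.
have pos : (0 < ((2 ^- n)%R : R)%:E)%E by rewrite lte_fin invr_gt0 exprn_gt0.
pose A := \bigcup_(u in [set u | fconnect (@past_map psi n) s u]) cylinder u.
have mA : measurable A.
  by apply: fin_bigcup_measurable => // u _; exact: measurable_cylinder.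
have AE x : A x <-> fconnect (@past_map psi n) s (past n x).
  split=> [[u su xu]|sx]; last by exists (past n x).
  by rewrite /cylinder/= in xu; rewrite xu.
case: (erg A mA).
- apply/seteqP; split=> x /=; rewrite !AE -past_mapE -same_fconnect1_r//;
    exact: past_map_inj.
- move=> PA0; have := pos; rewrite -(probability_cylinder s) ltNge -PA0.
  rewrite le_measure ?inE//; first exact: measurable_cylinder.
  by move=> x xs; apply/AE; rewrite xs connect0.
- move=> PA1; have mt := measurable_cylinder t.
  have : (P (A `|` cylinder t) <= 1)%E.
    by apply: probability_le1; exact: measurableU.
  have -> : P (A `|` cylinder t) = (P A + P (cylinder t))%E.
    apply: measureU => //; apply/seteqP; split=> // x [/AE sx xt].
    by rewrite /cylinder/= in xt; rewrite xt in sx.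
  by rewrite PA1 probability_cylinder -EFinD lee_fin gerDl leNgt -lte_fin pos.
Qed.

(** An invariant event meets all cylinders of a given length with the same
probability, hence is independent of each of them, hence of itself. *)
Lemma single_orbit_ergodic :
  (forall n, single_orbit (@past_map psi n)) -> ergodic P T.
Proof.
move=> Tn A mA TA.
have PAcyl_iter n (s : n.-tuple pm1) i :
    P (A `&` cylinder (iter i (@past_map psi n) s)) = P (A `&` cylinder s).
  elim: i => //= i <-; rewrite -measure_preserving; last first.
    by apply: measurableI => //; exact: measurable_cylinder.
  by rewrite preimage_setI TA preimage_cylinder.
have PAcyl n (s t : n.-tuple pm1) : P (A `&` cylinder t) = P (A `&` cylinder s).
  by rewrite -(iter_findex (Tn n s t)) PAcyl_iter.
have PA_fin : P A \is a fin_num by rewrite fin_num_measure.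
have PAI n (s : n.-tuple pm1) : P (A `&` cylinder s) = (P A * P (cylinder s))%E.
  have ms t : measurable (A `&` @cylinder n t).
    by apply: measurableI => //; exact: measurable_cylinder.
  have PAs_fin : P (A `&` cylinder s) \is a fin_num by rewrite fin_num_measure.
  have PAE : P A = (\sum_(t : n.-tuple pm1) P (A `&` cylinder t))%E.
    rewrite (fsbig_seq _ _ (index_enum_uniq _)) -measure_fin_bigcup//.
    - congr (P _); apply/seteqP; split=> x; last by case=> t _ [].
      by move=> Ax; exists (past n x) => //=; rewrite mem_index_enum.
    - by move=> t u _ _ [x [[_ xt] [_ xu]]]; rewrite -xt -xu.
  rewrite probability_cylinder PAE (eq_bigr (fun=> P (A `&` cylinder s))) => [|t _].
    rewrite -(fineK PAs_fin) sumEFin sumr_const card_pm1_tuple -EFinM.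
    by rewrite -[_ *+ (2 ^ n)]mulr_natr natrX mulfK// expf_neq0// pnatr_eq0.
  exact: PAcyl.
have PA0 : 0 <= fine (P A) by rewrite fine_ge0.
have : P (A `&` A) = (P A * P A)%E.
  rewrite -{1}(fineK PA_fin).
  apply: (@eq_measure_cylinders R (mrestr P mA) (mscale (NngNum PA0) P)) => //.
    by rewrite /= /mrestr setTI -ge0_fin_numE.
  by move=> n s; rewrite /= /mrestr /mscale /= fineK// setIC PAI.
rewrite setIid -(fineK PA_fin) -EFinM => -[PAA].
have /eqP : fine (P A) * (1 - fine (P A)) = 0 by rewrite mulrBr mulr1 -PAA subrr.
by rewrite mulf_eq0 subr_eq0 => /orP[/eqP ->|/eqP <-]; [left|right].
Qed.

End ergodicity.

Theorem theorem22 (R : realType) (P : probability Omega R)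
    (hP : simple_symmetric_random_walk P)
    (psi : forall n : nat, n.-tuple pm1 -> pm1) :
  (ergodic P (transformation psi) <->
     val (psi 0%N [tuple]) = -1 /\
     forall n : nat, (1 <= n)%N ->
       \prod_(u : n.-tuple pm1) val (psi n u) = -1)
  /\
  (ergodic P (transformation psi) <->
     val (psi 0%N [tuple]) = -1 /\
     forall n : nat, (1 <= n)%N ->
       coef (psi n) [set: 'I_n]%SET = 1%N :> nat).
Proof.
have ergodicP : ergodic P (transformation psi) <->
    val (psi 0%N [tuple]) = -1 /\
    forall n : nat, (1 <= n)%N -> \prod_(u : n.-tuple pm1) val (psi n u) = -1.
  have prod0 : \prod_(u : 0.-tuple pm1) val (psi 0%N u) = val (psi 0%N [tuple]).
    by apply: big_pred1 => u; apply/esym/eqP/tuple0.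
  rewrite (_ : ergodic _ _ <-> forall n, single_orbit (@past_map psi n)).
    rewrite single_orbit_pastP; split=> [psiN|[psi0 psiN] [|n]].
    - by rewrite -prod0.
    - by rewrite prod0.
    - exact: psiN.
  split; last exact: single_orbit_ergodic.
  by move=> erg n; apply: ergodic_single_orbit erg.
split=> //; rewrite ergodicP.
have coefP n : \prod_(u : n.-tuple pm1) val (psi n u) = -1 <->
    coef (psi n) [set: 'I_n]%SET = 1%N :> nat.
  by rewrite prod_coef; case: (coef _ _).
by split=> -[psi0 psiN]; split=> // n n1; apply/coefP/psiN.
Qed.
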